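(* Let $i\in\{1,2\}$ and let $r,s,n\geq 0$ be integers. Let $H_i(r,s,n)$ denote the number of partitions of $n$ with exactly $r$ even parts and exactly $s$ odd parts such that (1) the odd parts are distinct, (2) if $r\geq 1$, the smallest even part is greater than or equal to $2\,(r+s+i-1)$ (where $r+s$ is the length, i.e. the total number of parts, of the partition), and (3) if $s\geq 1$, the smallest odd part is greater than or equal to $2i-1$. Let $G_i(r,s,n)$ denote the number of partitions of $n$ with exactly $r$ even parts and exactly $s$ odd parts such that all parts are greater than or equal to $2i-1$, no two parts are equal or consecutive integers (i.e. any two parts differ by at least $2$), and no two even parts are equal or consecutive even integers (i.e. any two even parts differ by at least $4$). Then $H_i(r,s,n)=G_i(r,s,n)$.
   Context: A partition of a nonnegative integer $n$ is a weakly decreasing finite sequence of positive integers (its parts) summing to $n$; the empty partition is the unique partition of $0$. The length of a partition is its number of parts. *)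

(* Defs.v *)
From mathcomp Require Import all_boot.

Set Implicit Arguments.
Unset Strict Implicit.
Unset Printing Implicit Defensive.

Definition is_partition (n : nat) (p : seq nat) : bool :=
  [&& sorted geq p, all (leq 1) p & sumn p == n].

(* A partition of n has at most n parts, each at most n, so the partitions of
   n are counted inside the finite type {bseq n of 'I_n.+1}; the lemmas
   [map_val_bseq_inj] and [partition_in_bseq] show that each partition of n is
   counted exactly once. *)
Definition num_partitions (n : nat) (P : pred (seq nat)) : nat :=
  #|[set b : {bseq n of 'I_n.+1} |
       is_partition n [seq val x | x <- b] && P [seq val x | x <- b]]|.

Lemma map_val_bseq_inj (n : nat) :
  injective (fun b : {bseq n of 'I_n.+1} => [seq val x | x <- b]).
Proof. by move=> b c /(inj_map val_inj)/val_inj. Qed.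

Lemma partition_in_bseq (n : nat) (p : seq nat) : is_partition n p ->
  exists b : {bseq n of 'I_n.+1}, [seq val x | x <- b] = p.
Proof.
case/and3P=> _ p_gt0 /eqP sum_p.
have size_p : size p <= n.
  rewrite -sum_p; elim: p p_gt0 {sum_p} => //= x p IHp /andP[x_gt0 /IHp].
  by rewrite -add1n; apply: leq_add.
have le_n x : x \in p -> x <= n.
  rewrite -sum_p; elim: p {p_gt0 sum_p size_p} => //= y p IHp.
  rewrite inE => /orP[/eqP-> | /IHp le_xp]; first exact: leq_addr.
  exact: leq_trans le_xp (leq_addl _ _).
have size_q : size [seq inord x : 'I_n.+1 | x <- p] <= n by rewrite size_map.
exists (Bseq size_q) => /=; rewrite -map_comp; apply: map_id_in => x /le_n xn /=.
by rewrite inordK.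
Qed.

Definition even (x : nat) : bool := ~~ odd x.

Definition evens (p : seq nat) : seq nat := filter even p.
Definition odds (p : seq nat) : seq nat := filter odd p.

(* The minimum of a nonempty sequence; it is 0 on the empty one. *)
Definition smallest (p : seq nat) : nat := foldr minn (head 0 p) p.

Definition differ_by_at_least (d : nat) : rel nat :=
  fun x y => (x + d <= y) || (y + d <= x).

Definition H_cond (i r s : nat) (p : seq nat) : bool :=
  [&& size (evens p) == r,
      size (odds p) == s,
      uniq (odds p),
      (1 <= r) ==> (2 * (r + s + i - 1) <= smallest (evens p)) &
      (1 <= s) ==> (2 * i - 1 <= smallest (odds p))].

(* [pairwise] ranges over pairs of distinct positions, so repeated parts are
   compared with each other. *)
Definition G_cond (i r s : nat) (p : seq nat) : bool :=
  [&& size (evens p) == r,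
      size (odds p) == s,
      all (leq (2 * i - 1)) p,
      pairwise (differ_by_at_least 2) p &
      pairwise (differ_by_at_least 4) (evens p)].

Definition H (i r s n : nat) : nat := num_partitions n (H_cond i r s).

Definition G (i r s n : nat) : nat := num_partitions n (G_cond i r s).

(* Main.v *)
Require Import Defs.
From mathcomp Require Import all_boot.
From mathcomp Require Import zify.

Set Implicit Arguments.
Unset Strict Implicit.
Unset Printing Implicit Defensive.

(** Both counts satisfy the same recurrence in [(r, s, n)].
    If [2i - 1] is a part, remove it and subtract 2 from the others.  Otherwise,
    if the least admissible even part occurs ([2 (r + s + i - 1)] for [H], [2i]
    for [G]), remove one copy of it and subtract 2 (for [H]) or 4 (for [G]) from
    the others.  Otherwise subtract 2 from all parts.  These three cases lead
    bijectively to the parameters [(r, s - 1, n - (2i - 1) - 2 (r + s - 1))],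
    [(r - 1, s, n - 2i - 4 (r + s - 1))] and [(r, s, n - 2 (r + s))], on both
    sides. *)

(** * Counting over a duplicate-free list of partitions *)

Definition partitions (n : nat) : seq (seq nat) :=
  [seq [seq val x | x <- b] |
     b : {bseq n of 'I_n.+1} in [set b : {bseq n of 'I_n.+1} |
       is_partition n [seq val x | x <- b]]].

Lemma partitions_uniq n : uniq (partitions n).
Proof. by rewrite map_inj_uniq ?enum_uniq //; apply: map_val_bseq_inj. Qed.

Lemma mem_partitions n p : (p \in partitions n) = is_partition n p.
Proof.
apply/mapP/idP => [[b] | pn]; first by rewrite mem_enum inE => ? ->.
have [b bE] := partition_in_bseq pn.
by exists b => //; rewrite mem_enum inE bE.
Qed.

(** Moves from cardinals over bounded sequences to lists of naturals, where bijections can be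
    checked with [uniq_perm]. *)
Lemma num_partitionsE n P : num_partitions n P = count P (partitions n).
Proof.
rewrite /num_partitions /partitions count_map -size_filter.
rewrite cardE; apply: perm_size; apply: uniq_perm.
- exact: enum_uniq.
- by rewrite filter_uniq ?enum_uniq.
by move=> b; rewrite mem_enum mem_filter mem_enum !inE andbC.
Qed.

Lemma num_partitions_split n (P C : pred (seq nat)) :
  num_partitions n P =
    num_partitions n (fun p => P p && C p)
    + num_partitions n (fun p => P p && ~~ C p).
Proof.
rewrite !num_partitionsE; elim: (partitions n) => //= p ps ->.
by case: (P p); case: (C p); rewrite /=; lia.
Qed.

Lemma eq_num_partitions n (P Q : pred (seq nat)) :
  (forall p, all (leq 1) p -> P p = Q p) ->
  num_partitions n P = num_partitions n Q.
Proof.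
move=> PQ; rewrite !num_partitionsE; apply: eq_in_count => p.
by rewrite mem_partitions => /and3P[_ /PQ].
Qed.

Lemma num_partitions_eq0 n (P : pred (seq nat)) :
  (forall p, ~~ P p) -> num_partitions n P = 0.
Proof.
move=> nP; rewrite num_partitionsE -size_filter.
by rewrite (eq_filter (a2 := pred0)) ?filter_pred0 // => p; apply: negbTE.
Qed.

(** * Transport of counts along a shift of the parts *)

Definition perm_invariant (P : pred (seq nat)) :=
  forall p q, perm_eq p q -> P p = P q.

Lemma sumn_map_addn d q : sumn [seq d + x | x <- q] = d * size q + sumn q.
Proof. by elim: q => [|x q /= ->]; rewrite ?muln0 //= mulnS; lia. Qed.

Lemma geq_trans : transitive geq.
Proof. by move=> x y z yx xz; apply: leq_trans xz yx. Qed.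

Lemma geq_anti : antisymmetric geq.
Proof. by move=> x y /=; lia. Qed.

Lemma geq_total : total geq.
Proof. by move=> x y /=; lia. Qed.

(* The bijection adds [d] to every part and then inserts the parts [xs]. *)
Lemma num_partitions_shift n xs d l k (P Q : pred (seq nat)) :
  k = sumn xs + d * l -> all (leq 1) xs -> perm_invariant P ->
  (forall q, Q q -> size q = l) ->
  (forall p, all (leq 1) p -> P p ->
     exists2 t, perm_eq p (xs ++ t) & all (leq d.+1) t) ->
  (forall q, all (leq 1) q -> P (xs ++ [seq d + x | x <- q]) = Q q) ->
  num_partitions n P =
    if k <= n then num_partitions (n - k) Q else 0.
Proof.
move=> -> xs0 invP sizeQ splitP PQ.
(* Sorting restores weak decrease after the insertion of [xs]; [P] does not notice it, being
   permutation invariant. *)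
pose f q := sort geq (xs ++ [seq d + x | x <- q]).
have fP q : perm_eq (f q) (xs ++ [seq d + x | x <- q]).
  by rewrite /f perm_sort.
(* Surjectivity, stated without fixing the sum so that it also serves when [k > n]. All entries of
   [t] exceed [d], so truncated subtraction of [d] is exact and leaves positive parts. *)
have onto p : all (leq 1) p -> P p ->
    exists q, [/\ all (leq 1) q, sorted geq q, Q q &
                 perm_eq p (xs ++ [seq d + x | x <- q])].
  move=> p0 Pp; have [t pt td] := splitP p p0 Pp.
  have tE : [seq d + x | x <- [seq x - d | x <- t]] = t.
    rewrite -map_comp; apply: map_id_in => x /(allP td) /=; lia.
  exists (sort geq [seq x - d | x <- t]).
  have pq : perm_eq p
      (xs ++ [seq d + x | x <- sort geq [seq x - d | x <- t]]).
    apply: (perm_trans pt); rewrite perm_cat2l -{1}tE.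
    by apply: perm_map; rewrite perm_sym perm_sort.
  have q0 : all (leq 1) (sort geq [seq x - d | x <- t]).
    rewrite all_sort all_map; apply/allP => x /(allP td) /=; lia.
  split=> //; first by apply: sort_sorted; apply: geq_total.
  by rewrite -PQ // -(invP _ _ pq).
have sum_f q : sumn (f q) = sumn xs + (d * size q + sumn q).
  by rewrite (perm_sumn (fP q)) sumn_cat sumn_map_addn.
case: ifP => [le_n | /negbT gt_n]; rewrite !num_partitionsE -!size_filter.
  rewrite -[RHS](size_map f); apply: perm_size; apply: uniq_perm.
  - by rewrite filter_uniq ?partitions_uniq.
  - rewrite map_inj_in_uniq ?filter_uniq ?partitions_uniq // => q q'.
    rewrite !mem_filter !mem_partitions.
    move=> /andP[_ /and3P[q_sorted _ _]] /andP[_ /and3P[q'_sorted _ _]] eqf.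
    (* Injectivity: a sorted sequence is determined up to permutation, and both [xs] and the shift
       cancel in [perm_eq]. *)
    apply: (sorted_eq geq_trans geq_anti) => //.
    have := fP q; rewrite eqf (perm_sym (f q')) => /perm_trans/(_ (fP q')).
    by rewrite perm_cat2l => /perm_map_inj; apply; apply: addnI.
  move=> p; rewrite mem_filter mem_partitions.
  apply/andP/mapP => [[Pp /and3P[p_sorted p0 /eqP sum_p]] | [q]].
    have [q [q0 q_sorted Qq pq]] := onto p p0 Pp.
    have pf : p = f q.
      apply: (sorted_eq geq_trans geq_anti) => //.
        by apply: sort_sorted; apply: geq_total.
      by rewrite perm_sym; apply: perm_trans (fP q) _; rewrite perm_sym.
    exists q => //; rewrite mem_filter Qq mem_partitions /is_partition.
    rewrite q_sorted q0 /=; have := sum_f q; rewrite -pf (sizeQ q) //; lia.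
  rewrite mem_filter mem_partitions => /andP[Qq /and3P[_ q0 sum_q]] ->.
  split; first by rewrite (invP _ _ (fP q)) PQ.
  apply/and3P; split; first by apply: sort_sorted; apply: geq_total.
    rewrite (perm_all _ (fP q)) all_cat xs0 all_map.
    by apply/allP => x /(allP q0) /=; lia.
  rewrite sum_f (sizeQ q) //; lia.
(* Now [k > n]: a counted [p] would have a preimage, hence a sum of at least [k]. *)
apply/eqP; rewrite size_eq0 -(negbK (_ == _)) -has_filter; apply/hasPn => p.
rewrite mem_partitions => /and3P[_ p0 /eqP sum_p]; apply/negP => Pp.
have [q [_ _ Qq pq]] := onto p p0 Pp.
have := perm_sumn pq; rewrite sumn_cat sumn_map_addn (sizeQ q) //; lia.
Qed.

(** * The conditions under permutations and shifts *)

Lemma leq_smallest m p : 0 < size p -> (m <= smallest p) = all (leq m) p.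
Proof.
case: p => // x p _; rewrite /smallest /=.
have foldrE y : (m <= foldr minn y p) = (m <= y) && all (leq m) p.
  by elim: p => [|z p IHp] /=; rewrite ?andbT // leq_min IHp andbCA.
by rewrite leq_min foldrE andbA andbb.
Qed.

Lemma perm_invariant_pairwise (e : rel nat) :
  symmetric e -> perm_invariant (pairwise e).
Proof.
move=> e_sym.
have imp p q : perm_eq p q -> pairwise e p -> pairwise e q.
  (* It suffices to exchange two adjacent blocks; only the comparisons between [s1] and [s2] change
     direction, and [e] is symmetric. *)
  apply: (catCA_perm_ind (P := pairwise e)) => {p q} s1 s2 s3.
  rewrite !pairwise_cat !allrel_catr (allrelC _ s2 s1).
  rewrite (@eq_allrel _ _ (fun y => e^~ y) e) => [|x y]; last exact: e_sym.
  lia.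
by move=> p q pq; apply/idP/idP; apply: imp; rewrite // perm_sym.
Qed.

Lemma differ_by_at_least_sym d : symmetric (differ_by_at_least d).
Proof. by move=> x y; rewrite /differ_by_at_least orbC. Qed.

(** A bound on a minimum is a bound on every element, and it is vacuous on an empty list, which
    absorbs the guards [1 <= r] and [1 <= s]. In this form the effect of a shift can be checked part
    by part. *)
Lemma H_condE i r s p : H_cond i r s p =
  [&& size (evens p) == r, size (odds p) == s, uniq (odds p) &
      all (fun x => (if odd x then 2 * i - 1 else 2 * (r + s + i - 1)) <= x) p].
Proof.
have allE : all (fun x => (if odd x then 2 * i - 1
                           else 2 * (r + s + i - 1)) <= x) p =
    all (leq (2 * (r + s + i - 1))) (evens p)
    && all (leq (2 * i - 1)) (odds p).
  rewrite /evens /odds !all_filter -all_predI; apply: eq_all => x /=.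
  by rewrite /even; case: (odd x); rewrite ?andbT.
rewrite /H_cond allE; case: eqP => //= rE; case: eqP => //= sE.
congr (_ && (_ && _)).
  by case: r rE {allE} => [/size0nil-> | r rE] //; rewrite leq_smallest ?rE.
by case: s sE {allE} => [/size0nil-> | s sE] //; rewrite leq_smallest ?sE.
Qed.

Lemma H_cond_perm i r s : perm_invariant (H_cond i r s).
Proof.
move=> p q pq; rewrite !H_condE (perm_all _ pq).
have pq_odd : perm_eq (odds p) (odds q) by apply: perm_filter.
have pq_even : perm_eq (evens p) (evens q) by apply: perm_filter.
by rewrite (perm_size pq_odd) (perm_size pq_even) (perm_uniq pq_odd).
Qed.

Lemma G_cond_perm i r s : perm_invariant (G_cond i r s).
Proof.
move=> p q pq; rewrite /G_cond (perm_all _ pq).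
have pq_odd : perm_eq (odds p) (odds q) by apply: perm_filter.
have pq_even : perm_eq (evens p) (evens q) by apply: perm_filter.
rewrite (perm_size pq_odd) (perm_size pq_even).
by rewrite (perm_invariant_pairwise (@differ_by_at_least_sym 2) pq)
           (perm_invariant_pairwise (@differ_by_at_least_sym 4) pq_even).
Qed.

Lemma size_evens_odds p : size (evens p) + size (odds p) = size p.
Proof. by rewrite addnC !size_filter count_predC. Qed.

Lemma H_cond_size i r s p : H_cond i r s p -> size p = r + s.
Proof. by rewrite -size_evens_odds => /and3P[/eqP-> /eqP-> _]. Qed.

Lemma G_cond_size i r s p : G_cond i r s p -> size p = r + s.
Proof. by rewrite -size_evens_odds => /and3P[/eqP-> /eqP-> _]. Qed.

Lemma evens_map_addn d q :
  even d -> evens [seq d + x | x <- q] = [seq d + x | x <- evens q].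
Proof.
rewrite /evens filter_map /even => d0; congr map; apply: eq_filter => x /=.
by rewrite oddD (negbTE d0).
Qed.

Lemma odds_map_addn d q :
  even d -> odds [seq d + x | x <- q] = [seq d + x | x <- odds q].
Proof.
rewrite /odds filter_map /even => d0; congr map; apply: eq_filter => x /=.
by rewrite oddD (negbTE d0).
Qed.

Lemma pairwise_differ_map_addn c d q :
  pairwise (differ_by_at_least c) [seq d + x | x <- q] =
  pairwise (differ_by_at_least c) q.
Proof.
rewrite pairwise_map; apply: eq_pairwise => x y /=.
by rewrite /differ_by_at_least -!addnA !leq_add2l.
Qed.

(** Puts an absent value in the form of an [all], ready to be merged with the lower bounds on the
    parts. *)
Lemma notin_map_addn x d q :
  (x \notin [seq d + y | y <- q]) = all (fun y => x != d + y) q.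
Proof. by elim: q => //= y q IHq; rewrite inE negb_or IHq. Qed.

Lemma perm_invariant_mem x : perm_invariant (fun p => x \in p).
Proof. by move=> p q pq; rewrite (perm_mem pq). Qed.

Lemma perm_invariant_predN P :
  perm_invariant P -> perm_invariant (fun p => ~~ P p).
Proof. by move=> invP p q pq; rewrite (invP p q). Qed.

Lemma perm_invariant_predI P Q : perm_invariant P -> perm_invariant Q ->
  perm_invariant (fun p => P p && Q p).
Proof. by move=> invP invQ p q pq; rewrite (invP p q) ?(invQ p q). Qed.

(** Provides the splitting premise of [num_partitions_shift] when a single part [x] is removed. *)
Lemma split_part x d (P : pred (seq nat)) p :
  perm_invariant P -> x \in p -> P p -> all (leq 1) p ->
  (forall t, all (leq 1) t -> P (x :: t) -> all (leq d.+1) t) ->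
  exists2 t, perm_eq p ([:: x] ++ t) & all (leq d.+1) t.
Proof.
move=> invP xp Pp p0 ge_d; have px := perm_to_rem xp.
exists (rem x p) => //; move: p0; rewrite (perm_all _ px) /= => /andP[_ t0].
by apply: ge_d => //; rewrite -(invP _ _ px).
Qed.

Lemma size_evens_gt0 x p : x \in p -> odd x = false -> 0 < size (evens p).
Proof.
move=> xp x_even; rewrite -has_predT; apply/hasP; exists x => //.
by rewrite mem_filter /even x_even.
Qed.

Lemma size_odds_gt0 x p : x \in p -> odd x -> 0 < size (odds p).
Proof.
move=> xp x_odd; rewrite -has_predT; apply/hasP; exists x => //.
by rewrite mem_filter x_odd.
Qed.

(** * The three cases of the recurrence for [H] *)

Lemma H_minimal_odd i r s n : 0 < i ->
  num_partitions n (fun p => H_cond i r s.+1 p && (2 * i - 1 \in p)) =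
    if 2 * i - 1 + 2 * (r + s) <= n then H i r s (n - (2 * i - 1 + 2 * (r + s)))
    else 0.
Proof.
move=> i_gt0.
have odd_i : odd (2 * i - 1) by lia.
have invP : perm_invariant
    (fun p => H_cond i r s.+1 p && (2 * i - 1 \in p)).
  by apply: perm_invariant_predI (@H_cond_perm _ _ _) (@perm_invariant_mem _).
apply: (@num_partitions_shift _ [:: 2 * i - 1] 2 (r + s)) => //.
- by rewrite /= addn0.
- by rewrite /=; lia.
- by move=> q; apply: H_cond_size.
- move=> p p0 Pp; have [_ ip] := andP Pp; apply: (split_part invP ip Pp p0).
  move=> t t0 /=; rewrite H_condE /evens /odds /= /even odd_i /=.
  case/andP=> /and4P[/eqP r_t _ /andP[i_t _] /andP[_ t_ge] _].
  (* Each remaining part is at least 3: an odd one differs from [2 * i - 1] by distinctness, and an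
     even one forces [r > 0], so that the even bound is at least 4. *)
  apply/allP => x xt; move: (allP t_ge x xt) (allP t0 x xt) => /=.
  case: ifP => [odd_x | /(size_evens_gt0 xt)]; last by rewrite /evens r_t; lia.
  have : x != 2 * i - 1.
    by apply: contraNneq i_t => <-; rewrite mem_filter odd_x.
  lia.
move=> q q0; rewrite !H_condE /= inE eqxx andbT.
rewrite {1}/evens {1 2}/odds /= {1}/even odd_i /= -/(evens _) -/(odds _).
rewrite evens_map_addn // odds_map_addn // !size_map map_inj_uniq; last first.
  exact: addnI.
rewrite notin_map_addn all_map leqnn eqSS /= /odds all_filter.
congr (_ && (_ && _)); rewrite andbAC andbC -all_predI; congr (_ && _).
(* For odd [x], excluding [2 + x = 2 * i - 1] raises the bound by 2, by parity. For even [x], losing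
   one part lowers the even bound by 2, exactly the shift. *)
by apply: eq_in_all => x /(allP q0) /=; rewrite negbK; case: ifP; lia.
Qed.

(** The removed part [2 * (r + s + i)] and the shift of [r + s] parts by 2 weigh
    [2 * i + 4 * (r + s)] together, as do the part [2 * i] and a shift by 4 for [G]. Further copies
    of the removed part land on the new even bound. *)
Lemma H_minimal_even i r s n : 0 < i ->
  num_partitions n (fun p => (H_cond i r.+1 s p && (2 * i - 1 \notin p))
                             && (2 * (r.+1 + s + i - 1) \in p)) =
    if 2 * i + 4 * (r + s) <= n then H i r s (n - (2 * i + 4 * (r + s))) else 0.
Proof.
move=> i_gt0.
set x := 2 * (r.+1 + s + i - 1); have odd_x : odd x = false by lia.
have invP : perm_invariant
    (fun p => (H_cond i r.+1 s p && (2 * i - 1 \notin p)) && (x \in p)).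
  apply: perm_invariant_predI (@perm_invariant_mem _).
  apply: perm_invariant_predI (@H_cond_perm _ _ _) _.
  exact: perm_invariant_predN (@perm_invariant_mem _).
apply: (@num_partitions_shift _ [:: x] 2 (r + s)) => //.
- by rewrite /= addn0; lia.
- by rewrite /=; lia.
- by move=> q; apply: H_cond_size.
- move=> p p0 Pp; have [_ xp] := andP Pp; apply: (split_part invP xp Pp p0).
  move=> t t0; rewrite H_condE /evens /odds /= /even odd_x /= inE negb_or.
  case/andP=> /andP[/and4P[/eqP[r_t] _ _ /andP[_ t_ge]] /andP[_ i_t] _].
  apply/allP => y yt; move: (allP t_ge y yt) (allP t0 y yt) => /=.
  case: ifP => [odd_y | /(size_evens_gt0 yt)]; last by rewrite /evens r_t; lia.
  have : y != 2 * i - 1 by apply: contraNneq i_t => <-.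
  lia.
move=> q q0; rewrite !H_condE /= !inE eqxx andbT negb_or.
have -> /= : 2 * i - 1 != x by lia.
rewrite {1}/evens {1 2}/odds /= {1}/even odd_x /= -/(evens _) -/(odds _).
rewrite evens_map_addn // odds_map_addn // !size_map map_inj_uniq; last first.
  exact: addnI.
rewrite notin_map_addn all_map leqnn eqSS /= -!andbA -all_predI.
congr (_ && (_ && (_ && _))).
apply: eq_in_all => y /(allP q0) /=; rewrite negbK /x; case: ifP; lia.
Qed.

(** With both boundary values absent, parity puts every part at least 2 above its bound; the length,
    hence each bound, is unchanged. *)
Lemma H_no_minimal i r s n : 0 < i ->
  num_partitions n (fun p => (H_cond i r s p && (2 * i - 1 \notin p))
                             && (2 * (r + s + i - 1) \notin p)) =
    if 2 * (r + s) <= n then H i r s (n - 2 * (r + s)) else 0.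
Proof.
move=> i_gt0.
set x := 2 * (r + s + i - 1).
apply: (@num_partitions_shift _ [::] 2 (r + s)) => //.
- do 2![apply: perm_invariant_predI;
        last exact: perm_invariant_predN (@perm_invariant_mem _)].
  exact: H_cond_perm.
- by move=> q; apply: H_cond_size.
- move=> p p0; rewrite H_condE.
  case/andP=> /andP[/and4P[/eqP r_p _ _ p_ge] i_p x_p]; exists p => //.
  apply/allP => y yp; move: (allP p_ge y yp) (allP p0 y yp) => /=.
  have : y != x by apply: contraNneq x_p => <-.
  have : y != 2 * i - 1 by apply: contraNneq i_p => <-.
  rewrite /x; case: ifP => [|odd_y]; first lia.
  have := size_evens_gt0 yp odd_y; lia.
move=> q q0; rewrite !H_condE /=.
rewrite evens_map_addn // odds_map_addn // !size_map map_inj_uniq; last first.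
  exact: addnI.
rewrite !notin_map_addn all_map -!andbA -!all_predI.
congr (_ && (_ && (_ && _))).
apply: eq_in_all => y /(allP q0) /=; rewrite negbK /x; case: ifP; lia.
Qed.

(** * The three cases of the recurrence for [G] *)

Lemma G_minimal_odd i r s n : 0 < i ->
  num_partitions n (fun p => G_cond i r s.+1 p && (2 * i - 1 \in p)) =
    if 2 * i - 1 + 2 * (r + s) <= n then G i r s (n - (2 * i - 1 + 2 * (r + s)))
    else 0.
Proof.
move=> i_gt0.
have odd_i : odd (2 * i - 1) by lia.
have invP : perm_invariant
    (fun p => G_cond i r s.+1 p && (2 * i - 1 \in p)).
  by apply: perm_invariant_predI (@G_cond_perm _ _ _) (@perm_invariant_mem _).
apply: (@num_partitions_shift _ [:: 2 * i - 1] 2 (r + s)) => //.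
- by rewrite /= addn0.
- by rewrite /=; lia.
- by move=> q; apply: G_cond_size.
- move=> p p0 Pp; have [_ ip] := andP Pp; apply: (split_part invP ip Pp p0).
  move=> t t0; rewrite /G_cond /=.
  case/andP=> /and5P[_ _ /andP[_ t_ge] /andP[i_t _] _ _].
  (* The lower bound and the gap of 2 from [2 * i - 1] give [x >= 2 * i + 1]. *)
  apply/allP => x xt; move: (allP t_ge x xt) (allP i_t x xt) => /=.
  by rewrite /differ_by_at_least; lia.
move=> q q0; rewrite /G_cond /= inE eqxx andbT.
rewrite {1 3}/evens {1}/odds /= {1 3}/even odd_i /= -/(evens _) -/(odds _).
rewrite evens_map_addn // odds_map_addn // !size_map !pairwise_differ_map_addn.
rewrite !all_map leqnn eqSS /= !andbA.
rewrite -(andbA _ (all _ _) (all _ _)) -all_predI.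
congr (_ && _ && _ && _); apply: eq_in_all => x /(allP q0) /=.
rewrite /differ_by_at_least; lia.
Qed.

(** Next to the part [2 * i], odd parts are at least [2 * i + 3] (gap 2 and parity) and even parts
    at least [2 * i + 4] (gap 4). Lowering them by 4 thus restores precisely the bound
    [2 * i - 1]. *)
Lemma G_minimal_even i r s n : 0 < i ->
  num_partitions n (fun p => (G_cond i r.+1 s p && (2 * i - 1 \notin p))
                             && (2 * i \in p)) =
    if 2 * i + 4 * (r + s) <= n then G i r s (n - (2 * i + 4 * (r + s))) else 0.
Proof.
move=> i_gt0.
have odd_i : odd (2 * i) = false by lia.
have invP : perm_invariant
    (fun p => (G_cond i r.+1 s p && (2 * i - 1 \notin p)) && (2 * i \in p)).
  apply: perm_invariant_predI (@perm_invariant_mem _).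
  apply: perm_invariant_predI (@G_cond_perm _ _ _) _.
  exact: perm_invariant_predN (@perm_invariant_mem _).
apply: (@num_partitions_shift _ [:: 2 * i] 4 (r + s)) => //.
- by rewrite /= addn0; lia.
- by rewrite /=; lia.
- by move=> q; apply: G_cond_size.
- move=> p p0 Pp; have [_ ip] := andP Pp; apply: (split_part invP ip Pp p0).
  move=> t t0; rewrite /G_cond /evens /odds /= /even odd_i /= all_filter.
  case/andP=> /andP[/and5P[_ _ /andP[_ t_ge] /andP[i_t _] /andP[ie_t _]] _ _].
  apply/allP => x xt.
  move: (allP t_ge x xt) (allP i_t x xt) (allP ie_t x xt) => /=.
  by rewrite /differ_by_at_least; lia.
move=> q q0; rewrite /G_cond /= !inE eqxx andbT negb_or.
have -> /= : 2 * i - 1 != 2 * i by lia.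
rewrite {1 3}/evens {1}/odds /= {1 3}/even odd_i /= -/(evens _) -/(odds _).
rewrite evens_map_addn // odds_map_addn // !size_map !pairwise_differ_map_addn.
rewrite notin_map_addn !all_map /evens all_filter eqSS /=.
have -> /= : 2 * i - 1 <= 2 * i by lia.
set a1 := all _ q; set a2 := all _ q; set a3 := all _ q; set a4 := all _ q.
(* The lower bound, the absence of [2 * i - 1] and the two gaps from [2 * i], all read on [4 + x],
   amount to one bound on [x]. *)
have -> : all (leq (2 * i - 1)) q = [&& a1, a2, a3 & a4].
  rewrite /a1 /a2 /a3 /a4 -!all_predI; apply: eq_in_all => x /(allP q0) /=.
  rewrite /differ_by_at_least /even; lia.
lia.
Qed.

(** All parts are then at least [2 * i + 1], and a shift by 2 preserves gaps and parities. *)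
Lemma G_no_minimal i r s n : 0 < i ->
  num_partitions n (fun p => (G_cond i r s p && (2 * i - 1 \notin p))
                             && (2 * i \notin p)) =
    if 2 * (r + s) <= n then G i r s (n - 2 * (r + s)) else 0.
Proof.
move=> i_gt0.
apply: (@num_partitions_shift _ [::] 2 (r + s)) => //.
- do 2![apply: perm_invariant_predI;
        last exact: perm_invariant_predN (@perm_invariant_mem _)].
  exact: G_cond_perm.
- by move=> q; apply: G_cond_size.
- move=> p p0; case/andP=> /andP[/and5P[_ _ p_ge _ _] i_p x_p]; exists p => //.
  apply/allP => y yp; move: (allP p_ge y yp) (allP p0 y yp) => /=.
  have : y != 2 * i by apply: contraNneq x_p => <-.
  have : y != 2 * i - 1 by apply: contraNneq i_p => <-.
  lia.
move=> q q0; rewrite /G_cond /=.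
rewrite evens_map_addn // odds_map_addn // !size_map !pairwise_differ_map_addn.
rewrite !notin_map_addn all_map.
set a1 := all _ q; set a2 := all _ q; set a3 := all _ q.
have -> : all (leq (2 * i - 1)) q = [&& a1, a2 & a3].
  rewrite /a1 /a2 /a3 -!all_predI; apply: eq_in_all => x /(allP q0) /=; lia.
lia.
Qed.

Theorem theorem2p1 (i r s n : nat) (hi : i = 1 \/ i = 2) :
  H i r s n = G i r s n.
Proof.
have i_gt0 : 0 < i by case: hi => ->.
elim/ltn_ind: n r s => n IHn r s.
(* Packaged in the shape of the recurrences: every case with [r + s > 0] removes a positive weight
   [k]. *)
have IH k r' s' : 0 < k ->
    (if k <= n then H i r' s' (n - k) else 0) =
    (if k <= n then G i r' s' (n - k) else 0).
  by move=> k_gt0; case: ifP => // le_kn; apply: IHn; lia.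
(* For [r + s = 0] the third case would remove weight 0, so it is settled directly: only the empty
   sequence can satisfy either condition. *)
have [|rs_gt0] := posnP (r + s).
  move/eqP; rewrite addn_eq0 => /andP[/eqP-> /eqP->].
  apply: eq_num_partitions => p _.
  by case: (posnP (size p)) => [/size0nil-> //|p_gt0]; apply/idP/idP;
     [move/H_cond_size | move/G_cond_size]; lia.
rewrite /H /G (num_partitions_split _ _ (fun p => 2 * i - 1 \in p)).
rewrite [RHS](num_partitions_split _ _ (fun p => 2 * i - 1 \in p)).
congr (_ + _).
  case: s {rs_gt0} => [|s]; last first.
    by rewrite H_minimal_odd // G_minimal_odd // IH //; lia.
  (* For [s = 0] the odd number [2 * i - 1] cannot be a part, so both counts vanish. *)
  rewrite !num_partitions_eq0 // => p; apply/andP=> -[/and3P[_ /eqP s0 _]];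
  by move=> /size_odds_gt0; rewrite s0; lia.
(* The two sides are split at different even values, each the least admissible one on its side; only
   the resulting counts are compared. *)
rewrite (num_partitions_split _ _ (fun p => 2 * (r + s + i - 1) \in p)).
rewrite [RHS](num_partitions_split _ _ (fun p => 2 * i \in p)).
congr (_ + _); last by rewrite H_no_minimal // G_no_minimal // IH //; lia.
case: r {rs_gt0} => [|r]; last first.
  by rewrite H_minimal_even // G_minimal_even // IH //; lia.
rewrite !num_partitions_eq0 // => p;
  apply/andP=> -[/andP[/and3P[/eqP r0 _ _] _] /size_evens_gt0];
  by rewrite r0; lia.
Qed.
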